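(* Let $r \ge k > p > 1$ be integers. Then the limit $\lim_{m\to\infty} d_{p,r}^k(m)/m^{(p-1)/(k-1)}$ (over integers $m$) exists and $$\lim_{m \to \infty} \frac{d_{p,r}^k(m)}{m^{\frac{p-1}{k-1}}} = \binom{r-1}{p-1}\binom{r-1}{k-1}^{-\frac{p-1}{k-1}}.$$
   Context: The Turán graph $T_{n,r}$ partitions $n$ vertices into $r$ parts as evenly as possible, with two vertices adjacent exactly when in different parts; $\binom{n}{k}_r$ denotes the number of $k$-vertex cliques of $T_{n,r}$. For $m > 0$, $j_k^r(m)$ is the unique integer with $\binom{j_k^r(m)}{k-1}_{r-1} \le m < \binom{j_k^r(m)+1}{k-1}_{r-1}$, and $d_{p,r}^k$ is defined on integers $m \ge 0$ by $d_{p,r}^k(0) = 0$ and $d_{p,r}^k(m) = \binom{j_k^r(m)}{p-1}_{r-1} + d_{p,r}^k\!\left(m - \binom{j_k^r(m)}{k-1}_{r-1}\right)$ for $m > 0$. *)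

(* Defs.v *)
From mathcomp Require Import all_boot all_order all_algebra.
From mathcomp Require Import all_classical all_reals all_analysis.

Set Implicit Arguments.
Unset Strict Implicit.
Unset Printing Implicit Defensive.

Local Open Scope nat_scope.

(* The parts of T_{n,r} are the residue classes modulo r of {0, ..., n-1}:
   their sizes are n %/ r or (n %/ r).+1. *)
Definition turan_adj (n r : nat) : rel 'I_n :=
  fun u v => u %% r != v %% r.

Definition is_clique (T : finType) (e : rel T) (A : {set T}) : bool :=
  [forall u in A, forall v in A, (u != v) ==> e u v].

Lemma is_cliqueP (T : finType) (e : rel T) (A : {set T}) :
  reflect {in A &, forall u v, u != v -> e u v} (is_clique e A).
Proof.
apply: (iffP idP) => [/forall_inP H u v uA vA uv|H].
  by have /forall_inP/(_ v vA)/implyP := H u uA; exact.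
apply/forall_inP => u uA; apply/forall_inP => v vA; apply/implyP; exact: H.
Qed.

Definition turan_binom (n k r : nat) : nat :=
  #|[set A : {set 'I_n} | (#|A| == k) && is_clique (@turan_adj n r) A]|.

(* "The" j such that ...; [turan_indexP] and [turan_index_uniq] below show that
   it exists and is unique when 1 < k <= r and 0 < m. *)
Definition turan_index (k r m : nat) : nat :=
  xget 0 [set j | turan_binom j k.-1 r.-1 <= m < turan_binom j.+1 k.-1 r.-1]%classic.

(* The extra argument bounds the recursion depth: each step decreases m, hence
   m steps suffice. The defining equations are [turan_d0] and [turan_dE]. *)
Fixpoint turan_d_rec (p r k fuel m : nat) : nat :=
  if fuel is fuel'.+1 then
    if m == 0 then 0 else
      turan_binom (turan_index k r m) p.-1 r.-1 +
      turan_d_rec p r k fuel' (m - turan_binom (turan_index k r m) k.-1 r.-1)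
  else 0.

Definition turan_d (p r k m : nat) : nat := turan_d_rec p r k m m.

Lemma turan_binomS n k r : turan_binom n k r <= turan_binom n.+1 k r.
Proof.
have winj : injective (@widen_ord n n.+1 (leqnSn n)).
  by move=> x y /(congr1 val) /= /val_inj.
rewrite /turan_binom -(card_imset _ (imset_inj winj)).
apply: subset_leq_card; apply/fintype.subsetP => B /imsetP[A].
rewrite inE => /andP[/eqP cA /is_cliqueP clA] ->.
rewrite inE card_imset // cA eqxx /=.
apply/is_cliqueP => _ _ /imsetP[u uA ->] /imsetP[v vA ->].
rewrite (inj_eq winj); exact: clA.
Qed.

Lemma turan_binom_le k r m n :
  m <= n -> turan_binom m k r <= turan_binom n k r.
Proof.
move: m n; apply: (@homo_leq _ (fun n => turan_binom n k r) leq) => [//|y x z|n]; [exact: leq_trans|exact: turan_binomS].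
Qed.

Lemma turan_binom_le_bin n k r : turan_binom n k r <= 'C(n, k).
Proof.
have := card_draws 'I_n k; rewrite card_ord => <-.
by apply: subset_leq_card; apply/fintype.subsetP => A; rewrite !inE => /andP[].
Qed.

Lemma turan_binom_gt k r m : 0 < k <= r -> m < turan_binom (k + r * m) k r.
Proof.
case: k => // k /= kr; set n := k.+1 + r * m.
have nE : n = (k + r * m).+1 by rewrite /n addSn.
pose g (t i : nat) := if i < k then i else k + r * t.
have gn (t : 'I_m.+1) (i : 'I_k.+1) : g t i < n.
  rewrite nE ltnS /g; case: ifP => ik.
    by rewrite (leq_trans (ltnW ik)) // leq_addr.
  by rewrite leq_add2l leq_mul2l -ltnS ltn_ord orbT.
pose f t i := Ordinal (gn t i).
have fr t i : f t i %% r = i.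
  rewrite /= /g; case: ltnP => ik.
    by rewrite modn_small // (leq_trans _ kr) // ltnW.
  have -> : val i = k by apply/eqP; rewrite eqn_leq ik -ltnS ltn_ord.
  by rewrite addnC mulnC modnMDl modn_small.
have finj t : injective (f t).
  by move=> i j /(congr1 (fun x : 'I_n => x %% r)); rewrite !fr => /val_inj.
pose A t := [set f t i | i : 'I_k.+1].
have Ainj : injective A.
  move=> t t' AA; have : f t ord_max \in A t' by rewrite -AA; exact: imset_f.
  case/imsetP => i _ e.
  have ei : i = ord_max.
    by apply: val_inj; have := fr t' i; rewrite -e fr.
  move: e; rewrite ei => /(congr1 val) /=; rewrite /g /= ltnn => /addnI/eqP.
  rewrite eqn_mul2l => /orP[/eqP r0|/eqP/val_inj //].
  by move: kr; rewrite r0.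
rewrite -[m.+1]card_ord -(card_imset _ Ainj).
apply: subset_leq_card; apply/fintype.subsetP => B /imsetP[t _ ->].
rewrite inE card_imset // card_ord eqxx /=.
apply/is_cliqueP => _ _ /imsetP[i _ ->] /imsetP[j _ ->].
rewrite (inj_eq (@finj t)) /turan_adj !fr.
by apply: contraNN => /eqP/val_inj ->.
Qed.

Lemma turan_index_uniq k r m i j :
  turan_binom i k.-1 r.-1 <= m < turan_binom i.+1 k.-1 r.-1 ->
  turan_binom j k.-1 r.-1 <= m < turan_binom j.+1 k.-1 r.-1 -> i = j.
Proof.
move=> /andP[i1 i2] /andP[j1 j2]; apply/eqP; rewrite eqn_leq.
apply/andP; split; rewrite leqNgt; apply/negP => /(@turan_binom_le k.-1 r.-1).
- by move=> /(leq_trans j2)/leq_trans/(_ i1); rewrite ltnn.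
- by move=> /(leq_trans i2)/leq_trans/(_ j1); rewrite ltnn.
Qed.

Lemma turan_indexP k r m : 1 < k <= r -> 0 < m ->
  turan_binom (turan_index k r m) k.-1 r.-1 <= m
    < turan_binom (turan_index k r m).+1 k.-1 r.-1.
Proof.
move=> /andP[k1 kr] m0; have kr' : 0 < k.-1 <= r.-1.
  by case: k r k1 kr {m0} => [|[|k]] [|r].
pose P n := m < turan_binom n k.-1 r.-1.
have exP : exists n, P n by eexists; exact: turan_binom_gt kr'.
have [[|n] Pn minn] := ex_minnP exP.
  move: Pn; rewrite /P => /leq_trans /(_ (turan_binom_le_bin _ _ _)).
  by case/andP: kr'; case: k.-1.
apply: (@xgetPex _ 0 [set j | turan_binom j k.-1 r.-1 <= m
    < turan_binom j.+1 k.-1 r.-1]%classic).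
exists n => /=; apply/andP; split=> //; rewrite leqNgt; apply/negP => /minn.
by rewrite ltnn.
Qed.

Lemma turan_binom_index_gt0 k r m : 1 < k <= r -> 0 < m ->
  0 < turan_binom (turan_index k r m) k.-1 r.-1.
Proof.
move=> kr m0; have /andP[_] := turan_indexP kr m0.
set j := turan_index k r m => mj.
have kr' : 0 < k.-1 <= r.-1.
  by case/andP: kr; case: k r {mj j} => [|[|k]] [|r].
have := turan_binom_gt 0 kr'; rewrite muln0 addn0 => T0.
have [kj|jk] := leqP k.-1 j; first by apply: (leq_trans T0); exact: turan_binom_le.
have /(leq_trans mj) := turan_binom_le k.-1 r.-1 jk.
move=> /leq_trans/(_ (turan_binom_le_bin _ _ _)).
by rewrite binn ltnS leqNgt m0.
Qed.

Lemma turan_d0 p r k : turan_d p r k 0 = 0.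
Proof. by []. Qed.

Lemma turan_dE p r k m : 1 < k <= r -> 0 < m ->
  turan_d p r k m =
    turan_binom (turan_index k r m) p.-1 r.-1 +
    turan_d p r k (m - turan_binom (turan_index k r m) k.-1 r.-1).
Proof.
move=> kr; have fuelP f1 f2 n : n <= f1 -> n <= f2 ->
    turan_d_rec p r k f1 n = turan_d_rec p r k f2 n.
  elim: f1 f2 n => [|f1 IH] [|f2] [|n] //= n1 n2.
  have T0 := turan_binom_index_gt0 kr (ltn0Sn n).
  congr (_ + _); apply: IH; rewrite -ltnS.
  - by rewrite (leq_trans _ n1) // ltn_subrL T0.
  - by rewrite (leq_trans _ n2) // ltn_subrL T0.
case: m => // m _; rewrite /turan_d /=; congr (_ + _).
apply: fuelP => //; rewrite -ltnS ltn_subrL.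
by rewrite turan_binom_index_gt0.
Qed.

(* Main.v *)
Require Import Defs.
From mathcomp Require Import all_boot all_order all_algebra.
From mathcomp Require Import all_classical all_reals all_analysis.
From mathcomp Require Import lra ring zify.
Import Order.TTheory GRing.Theory Num.Theory.
Import numFieldNormedType.Exports.

(* Write s = r-1, a = p-1, b = k-1, th = a/b, and T_c(n) for the number of
   c-cliques of T_{n,s}.  As T_c(qs) = 'C(s,c) q^c and T_c is monotone,
   T_c(n) / n^c tends to 'C(s,c) / s^c.  Sandwiching m between T_b(j) and
   T_b(j+1), with j = j(m) -> oo, gives T_b(j) ~ m and
   T_a(j) / m^th -> 'C(s,a) / 'C(s,b)^th.  Finally u(m) = d(m) / m^th satisfies
   u(m) = T_a(j) / m^th + (m'/m)^th u(m') with m' = m - T_b(j) = o(m), so u is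
   bounded and its limit is that of its first term. *)

Local Open Scope nat_scope.

(** * Cliques in Turán graphs with equal parts *)

(** Fibre over the support [B]: the functions with support exactly [B] are those of
    [pffun_on None B] that take only values other than [None] on [B]. *)
Lemma card_ffun_option_support (I T : finType) (c : nat) :
  #|[set f : {ffun I -> option T} | #|[set i | f i]| == c]|
    = 'C(#|I|, c) * #|T| ^ c.
Proof.
rewrite -sum1_card; under eq_bigl do rewrite inE.
rewrite (partition_big (fun f : {ffun I -> option T} => [set i | f i])
  (fun B : {set I} => #|B| == c)) //=.
rewrite -card_draws -sum_nat_const; apply: eq_big => [B|B /eqP cB].
  by rewrite inE.
have <- : #|predC1 (@None T)| = #|T| by rewrite cardC1 card_option.
rewrite -cB -(card_pffun_on None) -[RHS]sum1_card; apply: eq_bigl => f.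
apply/andP/pffun_onP => [[_ /eqP fB]|[/fintype.subsetP fB fT]].
  split; last by move=> _ /fintype.imageP[i iB ->]; move: iB; rewrite -fB !inE; case: (f i).
  by apply/fintype.subsetP => i; rewrite -fB !inE; case: (f i).
have -> : [set i | f i] = B.
  apply/setP => i; rewrite inE; apply/idP/idP => [fi|iB].
    by apply: fB; rewrite inE; case: (f i) fi.
  by have := fT (f i); rewrite fintype.image_f // inE; case: (f i) => // /(_ isT).
by rewrite !eqxx.
Qed.

(** A clique meets each of the s parts in at most one vertex, so it amounts to a partial function
    from parts to positions; the vertex x has part x %% s and position x %/ s. *)
Lemma turan_binom_mul (q c s : nat) : 0 < s ->
  turan_binom (q * s) c s = 'C(s, c) * q ^ c.
Proof.
move=> s0.
have qP (x : 'I_(q * s)) : x %/ s < q by rewrite ltn_divLR.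
have xP (t : 'I_q) (i : 'I_s) : t * s + i < q * s.
  by rewrite (leq_trans _ (leq_mul (ltn_ord t) (leqnn s))) // mulSnr ltn_add2l.
pose res (x : 'I_(q * s)) := Ordinal (ltn_pmod x s0).
pose quo x := Ordinal (qP x).
pose enc t i := Ordinal (xP t i).
have encK x : enc (quo x) (res x) = x by apply: val_inj; rewrite /= -divn_eq.
have resE t i : res (enc t i) = i.
  by apply: val_inj; rewrite /= modnMDl modn_small.
have quoE t i : quo (enc t i) = t.
  by apply: val_inj; rewrite /= divnMDl // divn_small ?addn0.
(* [f i = Some t] puts into the clique the t-th vertex of the part i. *)
pose A (f : {ffun 'I_s -> option 'I_q}) := [set x | f (res x) == Some (quo x)].
have Ainj : injective A.
  have H f g i t : A f = A g -> f i = Some t -> g i = Some t.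
    move=> /setP/(_ (enc t i)); rewrite !inE resE quoE => + fi.
    by rewrite fi eqxx => /esym/eqP.
  move=> f g fg; apply/ffunP => i; case Ef: (f i) => [t|].
    by rewrite (H f g i t).
  by case Eg: (g i) => [t|//]; rewrite (H g f i t) in Ef.
have res_inj f : {in A f &, injective res}.
  move=> x y; rewrite !inE => /eqP fx /eqP fy xy.
  move: fx; rewrite xy fy => -[qxy]; apply: val_inj.
  by rewrite /= (divn_eq x s) (divn_eq y s) qxy; move/(congr1 val): xy => /= ->.
have cardA f : #|A f| = #|[set i | f i]|.
  rewrite -(card_in_imset (res_inj f)); apply: eq_card => i; rewrite !inE.
  apply/imsetP/idP => [[x + ->]|]; first by rewrite inE => /eqP ->.
  by case fi: (f i) => [t|//] _; exists (enc t i); rewrite ?inE resE ?fi ?quoE.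
have := card_ffun_option_support 'I_s 'I_q c; rewrite !card_ord => <-.
rewrite -(card_imset _ Ainj); apply: eq_card => X; rewrite inE.
apply/andP/imsetP => [[cX /is_cliqueP clX]|[f]]; last first.
  rewrite inE => cf ->; rewrite cardA cf; split=> //; apply/is_cliqueP => u v uA vA.
  by apply: contraNneq => /eqP uv; apply/eqP/(res_inj f) => //; apply/val_inj/eqP.
pose f := [ffun i => [pick t | enc t i \in X]].
have XA : X = A f.
  apply/setP => x; rewrite inE ffunE; case: pickP => [t tX|/(_ (quo x))]; last first.
    by rewrite encK => ->.
  apply/idP/eqP => [xX|[tx]]; last by move: tX; rewrite tx encK.
  (* Two distinct vertices of the clique [X] cannot share a residue, so the picked position is that
     of [x]. *)
  congr Some; rewrite -[t](quoE t (res x)); congr quo; apply/eqP/contraT => ne.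
  by have := clX _ _ tX xX ne; rewrite /turan_adj -[_ == _]/(res _ == res x :> nat) resE eqxx.
by exists f; rewrite // inE -cardA -XA.
Qed.

Local Open Scope classical_set_scope.
Local Open Scope ring_scope.

(** * Limits of recursively defined sequences *)

Lemma cvg_recursion (R : realType) (u alpha beta : nat -> R) (f : nat -> nat)
    (L : R) :
  (forall m, (0 < m)%N -> (f m < m)%N) ->
  (forall m, (0 < m)%N -> u m = alpha m + beta m * u (f m)) ->
  alpha m @[m --> \oo] --> L -> beta m @[m --> \oo] --> (0 : R) ->
  u m @[m --> \oo] --> L.
Proof.
move=> fm uE alphaL beta0.
have [N [Nalpha Nbeta]] : exists N, (forall m, (N <= m)%N -> `|alpha m| <= `|L| + 1)
    /\ (forall m, (N <= m)%N -> `|beta m| <= 2^-1).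
  have /cvgrPdist_le/(_ 1 ltr01) [N1 _ H1] := alphaL.
  have /cvgr0Pnorm_le/(_ 2^-1) := beta0; rewrite invr_gt0 ltr0n.
  move=> /(_ isT) [N2 _ H2]; exists (maxn N1 N2); split=> m; rewrite geq_max.
    move=> /andP[/H1 /= H _]; rewrite -[alpha m](subKr L).
    by rewrite (le_trans (ler_normB _ _)) // lerD2l.
  by move=> /andP[_ /H2].
(* The sum covers the indices up to [N]; beyond [N], the factor 2 closes the strong induction, since
   (|L| + 1) + B / 2 <= B. *)
pose B := 2 * (`|L| + 1) + \sum_(i < N.+1) `|u i|.
have sum0 : 0 <= \sum_(i < N.+1) `|u i| by apply: sumr_ge0.
have B0 : 0 <= B by rewrite addr_ge0 // mulr_ge0 // addr_ge0.
have uB m : `|u m| <= B.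
  elim/ltn_ind: m => m IH; have [mN|Nm] := leqP m N.
    rewrite /B (bigD1 (Ordinal (mN : (m < N.+1)%N))) //= addrCA lerDl.
    by rewrite addr_ge0 ?mulr_ge0 ?addr_ge0 // sumr_ge0.
  have m0 : (0 < m)%N by exact: leq_ltn_trans Nm.
  rewrite uE // (le_trans (ler_normD _ _)) // normrM.
  have h1 := Nalpha _ (ltnW Nm).
  have h2 : `|beta m| * `|u (f m)| <= 2^-1 * B.
    by rewrite ler_pM ?normr_ge0 ?Nbeta ?IH ?fm // ltnW.
  by move: sum0 h1 h2; rewrite /B; lra.
rewrite -[L]addr0; apply: (@cvg_trans _ ((alpha m + beta m * u (f m)) @[m --> \oo])).
  by apply: near_eq_cvg; near=> m; rewrite [RHS]uE //; near: m; exact: nbhs_infty_gt.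
apply: cvgD => //; apply/norm_cvg0P.
apply: (@squeeze_cvgr _ _ _ _ (fun=> 0) (fun m => `|beta m| * B)).
- by near=> m; rewrite normr_ge0 normrM ler_wpM2l.
- exact: cvg_cst.
- by rewrite -(mul0r B); apply: cvgMr_tmp; apply/norm_cvg0P.
Unshelve. all: by end_near. Qed.

(** * Asymptotics of clique numbers and of real powers *)

Lemma cvg_invn (R : realType) : (n%:R : R)^-1 @[n --> \oo] --> (0 : R).
Proof.
apply/gtr0_cvgV0; last exact: cvgr_idn.
by near=> n; rewrite ltr0n; near: n; exact: nbhs_infty_gt.
Unshelve. all: by end_near. Qed.

Lemma cvg_ratioS (R : realType) :
  (n.+1%:R / n%:R : R) @[n --> \oo] --> (1 : R).
Proof.
apply: (@cvg_trans _ ((1 + n%:R^-1 : R) @[n --> \oo])).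
  apply: near_eq_cvg; near=> n.
  have n0 : n%:R != 0 :> R by rewrite pnatr_eq0 -lt0n; near: n; exact: nbhs_infty_gt.
  by rewrite -natr1 mulrDl divff // mul1r.
rewrite -[X in cvg_to _ (nbhs X)]addr0; apply: cvgD; [exact: cvg_cst|exact: cvg_invn].
Unshelve. all: by end_near. Qed.

Lemma cvg_divn (R : realType) (s : nat) : (0 < s)%N ->
  ((n %/ s)%:R / n%:R : R) @[n --> \oo] --> (s%:R^-1 : R).
Proof.
(* These bounds are n / s - 1 <= n %/ s <= n / s, divided by n. *)
move=> s0; apply: (@squeeze_cvgr _ _ _ _ (fun n => s%:R^-1 - n%:R^-1) (fun=> s%:R^-1)).
- near=> n.
  have n0 : (0 : R) < n%:R by rewrite ltr0n; near: n; exact: nbhs_infty_gt.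
  have s0' : (0 : R) < s%:R by rewrite ltr0n.
  rewrite ler_pdivlMr // mulrBl mulVf ?gt_eqF // ler_pdivrMr //.
  rewrite lerBlDr natr1 ![s%:R^-1 * _]mulrC ler_pdivrMr // ler_pdivlMr //.
  by rewrite -!natrM !ler_nat leq_divM andbT ltnW // -ltn_divLR.
- rewrite -[X in cvg_to _ (nbhs X)]subr0; apply: cvgB; [exact: cvg_cst|exact: cvg_invn].
- exact: cvg_cst.
Unshelve. all: by end_near. Qed.

(** By monotonicity the count at n lies between the exact counts at the multiples (n %/ s) * s and
    (n %/ s).+1 * s, which have the same leading term. *)
Lemma cvg_turan_binom (R : realType) (c s : nat) : (0 < s)%N ->
  ((turan_binom n c s)%:R / n%:R ^+ c : R) @[n --> \oo]
    --> ('C(s, c)%:R / s%:R ^+ c : R).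
Proof.
move=> s0.
have lim_of v : v n @[n --> \oo] --> (s%:R^-1 : R) ->
    ('C(s, c)%:R * v n ^+ c) @[n --> \oo] --> ('C(s, c)%:R / s%:R ^+ c : R).
  move=> vs; rewrite -exprVn; apply: cvgMl_tmp.
  by apply: (@continuous_cvg _ _ _ _ _ _ (@GRing.exp R ^~ c)) vs; exact: exprn_continuous.
have floor_le := lim_of _ (cvg_divn R s s0).
have ceil_ge := lim_of (fun n => (n %/ s).+1%:R / n%:R).
apply: (squeeze_cvgr _ floor_le (ceil_ge _)).
- near=> n; apply/andP; split; rewrite expr_div_n mulrA;
    rewrite ler_wpM2r ?invr_ge0 ?exprn_ge0 ?ler0n // -natrX -natrM ler_nat;
    rewrite -turan_binom_mul // turan_binom_le //.
  + exact: leq_divM.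
  + by rewrite ltnW // -ltn_divLR.
- rewrite -[X in cvg_to _ (nbhs X)]addr0.
  under eq_fun do rewrite -natr1 mulrDl mul1r.
  by apply: cvgD; [exact: cvg_divn|exact: cvg_invn].
Unshelve. all: by end_near. Qed.

Lemma cvg_powR (R : realType) (u : nat -> R) (l th : R) : 0 < l ->
  u n @[n --> \oo] --> l -> (u n `^ th) @[n --> \oo] --> l `^ th.
Proof.
move=> l0 ul; rewrite [X in cvg_to _ (nbhs X)]/powR gt_eqF //.
apply: (@cvg_trans _ ((expR (th * ln (u n))) @[n --> \oo])).
  apply: near_eq_cvg; near=> n; rewrite /powR gt_eqF //.
  by near: n; apply: (cvgr_gt l).
apply: (@continuous_cvg _ _ _ _ _ _ (@expR R)); first exact: continuous_expR.
by apply: cvgMl_tmp; apply: (@continuous_cvg _ _ _ _ _ _ (@ln R)) => //; exact: continuous_ln.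
Unshelve. all: by end_near. Qed.

Lemma cvg_powR0 (R : realType) (u : nat -> R) (th : R) : 0 < th ->
  (forall n, 0 <= u n) ->
  u n @[n --> \oo] --> (0 : R) -> (u n `^ th) @[n --> \oo] --> (0 : R).
Proof.
move=> th0 u0 ul; apply/cvgr0Pnorm_lt => e e0.
have /cvgr0Pnorm_lt/(_ (e `^ th^-1)) := ul; rewrite powR_gt0 // => /(_ isT).
apply: filterS => n; rewrite !ger0_norm ?powR_ge0 // => ue.
have := gt0_ltr_powR th0 (u0 n) (powR_ge0 _ _) ue.
by rewrite -powRrM mulVf ?gt_eqF // powRr1 // ltW.
Qed.

(** * Growth of the index j(m) *)

(** An index below A would give m < T_b(j+1) <= T_b(A), which fails as soon as m reaches the
    constant T_b(A). *)
Lemma cvg_turan_index (k r : nat) : (1 < k <= r)%N ->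
  turan_index k r m @[m --> \oo] --> \oo.
Proof.
move=> kr; apply/cvgnyPge => A; near=> m.
have m0 : (0 < m)%N by near: m; exact: nbhs_infty_gt.
have /andP[_ mj] := turan_indexP kr m0.
have Am : (turan_binom A k.-1 r.-1 <= m)%N by near: m; exact: nbhs_infty_ge.
rewrite -ltnS ltnNge; apply/negP => /(@turan_binom_le k.-1 r.-1).
by rewrite leqNgt (leq_ltn_trans Am mj).
Unshelve. all: by end_near. Qed.

Lemma cvg_div_turan_index (R : realType) (k r : nat) : (1 < k <= r)%N ->
  (m%:R / (turan_index k r m)%:R ^+ k.-1 : R) @[m --> \oo]
    --> ('C(r.-1, k.-1)%:R / r.-1%:R ^+ k.-1 : R).
Proof.
move=> kr; have s0 : (0 < r.-1)%N by lia.
have jy := cvg_turan_index _ _ kr.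
have Tj := cvg_comp _ _ jy (cvg_turan_binom R k.-1 _ s0).
have Tj1 : ((turan_binom (turan_index k r m).+1 k.-1 r.-1)%:R
      / (turan_index k r m)%:R ^+ k.-1 : R) @[m --> \oo]
    --> ('C(r.-1, k.-1)%:R / r.-1%:R ^+ k.-1 : R).
  pose v n : R := (turan_binom n.+1 k.-1 r.-1)%:R / n%:R ^+ k.-1.
  apply: (@cvg_comp _ _ _ (turan_index k r) v _ \oo) => //.
  (* The upper bound T_b(j+1) is normalised by j^b rather than (j+1)^b; the correction ((n+1)/n)^b
     tends to 1, so both bounds have the same limit. *)
  apply: (@cvg_trans _ (((turan_binom n.+1 k.-1 r.-1)%:R / n.+1%:R ^+ k.-1
      * (n.+1%:R / n%:R) ^+ k.-1 : R) @[n --> \oo])).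
    apply: near_eq_cvg; near=> n; rewrite /v expr_div_n mulrA divfK //.
  rewrite -[X in cvg_to _ (nbhs X)]mulr1 -[X in _ * X](expr1n R k.-1).
  apply: cvgM.
    have := cvg_turan_binom R k.-1 _ s0; rewrite -cvg_shiftS; exact.
  apply: (@continuous_cvg _ _ _ _ _ _ (@GRing.exp R ^~ k.-1)).
    exact: exprn_continuous.
  exact: cvg_ratioS.
apply: (squeeze_cvgr _ Tj Tj1); near=> m.
have m0 : (0 < m)%N by near: m; exact: nbhs_infty_gt.
have /andP[j1 j2] := turan_indexP kr m0.
by rewrite /= !ler_wpM2r ?invr_ge0 ?exprn_ge0 ?ler0n // ler_nat // ltnW.
Unshelve. all: by end_near. Qed.

(** * The limit of the normalised function d *)

Theorem theorem3p12 (R : realType) (p k r : nat)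
    (hp : (1 < p)%N) (hpk : (p < k)%N) (hkr : (k <= r)%N) :
  (turan_d p r k m)%:R / (m%:R `^ (p.-1%:R / k.-1%:R)) @[m --> \oo] -->
  ('C(r.-1, p.-1)%:R * 'C(r.-1, k.-1)%:R `^ (- (p.-1%:R / k.-1%:R)) : R).
Proof.
have kr : (1 < k <= r)%N by rewrite hkr andbT; lia.
have s0 : (0 < r.-1)%N by lia.
have s0' : (0 : R) < r.-1%:R by rewrite ltr0n.
have b0 : (0 : R) < k.-1%:R by rewrite ltr0n; lia.
have a0 : (0 : R) < p.-1%:R by rewrite ltr0n; lia.
set th : R := p.-1%:R / k.-1%:R.
have th0 : 0 < th by rewrite divr_gt0.
have Cb0 : (0 : R) < 'C(r.-1, k.-1)%:R by rewrite ltr0n bin_gt0; lia.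
have jy := cvg_turan_index _ _ kr.
have Ta := cvg_comp _ _ jy (cvg_turan_binom R p.-1 _ s0).
have Tb := cvg_comp _ _ jy (cvg_turan_binom R k.-1 _ s0).
have mj := cvg_div_turan_index R _ _ kr.
(* Since b * th = a, the power [th] turns the normalisation by j^b into the one by j^a. *)
have powXth (x : R) : 0 <= x -> (x ^+ k.-1)^-1 `^ th = (x ^+ p.-1)^-1.
  move=> x0; rewrite -!exprVn -!powR_mulrn ?invr_ge0 // -powRrM /th mulrCA.
  by rewrite divff ?mulr1 ?gt_eqF.
have lim_gt0 : (0 : R) < 'C(r.-1, k.-1)%:R / r.-1%:R ^+ k.-1.
  by rewrite divr_gt0 // exprn_gt0.
pose j := turan_index k r.
pose rem m := (m - turan_binom (j m) k.-1 r.-1)%N.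
pose alpha m : R := (turan_binom (j m) p.-1 r.-1)%:R / m%:R `^ th.
pose beta m : R := ((rem m)%:R / m%:R) `^ th.
apply: (@cvg_recursion _ _ alpha beta rem).
- by move=> m m0; rewrite /rem ltn_subrL m0 turan_binom_index_gt0.
- move=> m m0; rewrite turan_dE // natrD mulrDl; congr (_ + _).
  rewrite -[turan_index k r m]/(j m) -/(rem m) /beta.
  (* A zero remainder is treated apart: cancelling its power [th] requires it to be nonzero, while
     d(0) = 0 makes both sides vanish. *)
  have [->|rem0] := posnP (rem m); first by rewrite turan_d0 !mul0r mulr0.
  have -> : ((rem m)%:R / m%:R : R) `^ th = (rem m)%:R `^ th / m%:R `^ th.
    by rewrite powRM ?invr_ge0 ?ler0n // -powR_inv1 ?ler0n // -powRrM mulN1r powRN.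
  by rewrite [RHS]mulrC mulrA divfK // gt_eqF // powR_gt0 // ltr0n.
(* The powers of s = r-1 cancel because (s^b)^th = s^a. This form matches alpha(m) = (T_a(j) / j^a)
   / (m / j^b)^th, valid once m and j are positive. *)
- have -> : 'C(r.-1, p.-1)%:R * 'C(r.-1, k.-1)%:R `^ (- th) =
      ('C(r.-1, p.-1)%:R / r.-1%:R ^+ p.-1)
      / ('C(r.-1, k.-1)%:R / r.-1%:R ^+ k.-1) `^ th :> R.
    rewrite powRM ?invr_ge0 ?exprn_ge0 ?ler0n // powXth ?ler0n //.
    rewrite powRN; field.
    by rewrite expf_neq0 ?gt_eqF // powR_gt0.
  apply: (@cvg_trans _ (((turan_binom (j m) p.-1 r.-1)%:R / (j m)%:R ^+ p.-1
      / (m%:R / (j m)%:R ^+ k.-1) `^ th : R) @[m --> \oo])); last first.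
    apply: cvgM => //; apply: cvgV; first by rewrite gt_eqF // powR_gt0.
    exact: cvg_powR.
  apply: near_eq_cvg; near=> m; rewrite /alpha.
  have m0 : (0 : R) < m%:R by rewrite ltr0n; near: m; exact: nbhs_infty_gt.
  have jm0 : (0 : R) < (j m)%:R.
    by rewrite ltr0n; near: m; move/cvgnyPgt: jy; exact.
  rewrite powRM ?invr_ge0 ?exprn_ge0 ?ler0n // powXth ?ler0n //.
  field.
  by rewrite expf_neq0 ?gt_eqF // powR_gt0.
- apply: cvg_powR0 => //.
  (* Both T_b(j) / j^b and m / j^b tend to [l], so the relative remainder 1 - T_b(j) / m tends to 1
     - l / l = 0. *)
  pose l : R := 'C(r.-1, k.-1)%:R / r.-1%:R ^+ k.-1.
  have -> : (0 : R) = 1 - l / l by rewrite divff ?gt_eqF ?subrr.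
  apply: (@cvg_trans _ ((1 - ((turan_binom (j m) k.-1 r.-1)%:R / (j m)%:R ^+ k.-1)
      / (m%:R / (j m)%:R ^+ k.-1) : R) @[m --> \oo])); last first.
    apply: cvgB; [exact: cvg_cst|apply: cvgM => //].
    by apply: cvgV => //; rewrite gt_eqF.
  apply: near_eq_cvg; near=> m.
  have m0 : (0 < m)%N by near: m; exact: nbhs_infty_gt.
  have m0' : (0 : R) < m%:R by rewrite ltr0n.
  have jm0 : (0 : R) < (j m)%:R.
    by rewrite ltr0n; near: m; move/cvgnyPgt: jy; exact.
  have /andP[j1 _] := turan_indexP kr m0.
  rewrite /rem natrB //; field.
  by rewrite expf_neq0 ?gt_eqF.
Unshelve. all: by end_near. Qed.
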